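(* Let $k\geq3$ and $n\geq 3$, and write $n=2^tm$ with $t\geq 0$ and $m$ odd. Let $\delta=1$ if $k$ is odd and $\delta=2$ if $k$ is even. Let $X_k(n-1)$ be any set of edges of $B_k(n-1)$ obtained as the union of $E_k(n-1)$ with the edge sets of exactly one circuit from each reverse-complementary pair of non-negasymmetric circuits in $\mathcal{C}_k(n-1)$. Then \[ |X_k(n-1)|\geq \max\left(\frac{k^n-r_{k,n,kn/2}}{2},~s_k(n-1)\right), \] where \[ s_k(n-1) = \frac{k^n - n(|N_0(n,k)|+|N_2(n,k)|)-m(|N_1(n,k)|-\delta)-\delta}{2}, \] or equivalently \[ s_k(n-1)=\frac{k^n-\delta\left(n(k^{(n-1)/2}-1)+1\right)}{2}\ \text{ if $n$ is odd},\] \[ s_k(n-1)=\frac{k^n - \frac{nk^{(n-2)/2}}{2}(\delta^2+k) +n\delta k^{(m-1)/2} - m\delta(k^{(m-1)/2}-1)-\delta}{2}\ \text{ if $n$ is even}. \]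
   Context: Tuples are $k$-ary (entries in $\mathbb{Z}_k$), negation is modulo $k$, $\mathbf{u}^R$ is the reverse of $\mathbf{u}$; an $n$-tuple $\mathbf{u}$ is negasymmetric if $\mathbf{u}=-\mathbf{u}^R$. The pseudoweight of $a\in\mathbb{Z}_k$ is $a$ if $a\neq0$ and $k/2$ if $a=0$; the pseudoweight of a tuple is the sum over its entries. $r_{k,n,s}$ is the number of $k$-ary $n$-tuples of pseudoweight $s$. $B_k(n-1)$ is the de Bruijn digraph with vertices the $k$-ary $(n-1)$-tuples and edges the $k$-ary $n$-tuples $(a_0,\dots,a_{n-1})$, going from $(a_0,\dots,a_{n-2})$ to $(a_1,\dots,a_{n-1})$. $E_k(n-1)$ is the set of edges of pseudoweight less than $kn/2$; $H_k(n-1)$ is the subgraph with edges of pseudoweight exactly $kn/2$. For an $n$-tuple $(a_0,\dots,a_{n-1})$ with $m'$ the least positive $c$ such that $a_i=a_{(i+c)\bmod n}$ for all $i$, $[a_0,\dots,a_{n-1}]$ is the circuit with edges the $m'$ cyclic shifts $(a_j,\dots,a_{j+n-1})$ (indices mod $n$), $0\le j<m'$. $\mathcal{C}_k(n-1)$ is the set of such circuits arising from edges of $H_k(n-1)$. A circuit is negasymmetric if it contains edges $\mathbf{a},\mathbf{b}$ (not necessarily distinct) with $\mathbf{a}=-\mathbf{b}^R$, otherwise non-negasymmetric. A non-negasymmetric $[a_0,\dots,a_{n-1}]\in\mathcal{C}_k(n-1)$ and the (distinct, non-negasymmetric) circuit $[-a_{n-1},\dots,-a_0]$ form a reverse-complementary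 pair. For $i\ge0$, $N_i(n,k)$ is the set of negasymmetric circuits in $\mathcal{C}_k(n-1)$ that contain exactly $i$ negasymmetric $n$-tuples (as edges). *)

(* Defs.v *)
From HB Require Import structures.
From mathcomp Require Import all_boot all_order all_algebra.

Set Implicit Arguments.
Unset Strict Implicit.
Unset Printing Implicit Defensive.

Import Order.TTheory GRing.Theory Num.Theory.
Local Open Scope ring_scope.

(* Everything is used for k >= 2 only ('Z_k is the integers modulo k for
   k >= 2) and n >= 1. *)

(* The de Bruijn digraph B_k(n-1); all objects below that the mathematics
   indexes by n-1 are indexed here by the length n of the edges. *)
Definition dB_vertex (k n : nat) := (n.-1).-tuple 'Z_k.
Definition dB_edge (k n : nat) := n.-tuple 'Z_k.

Definition dB_source (k n : nat) (e : n.-tuple 'Z_k) : dB_vertex k n :=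
  [tuple nth 0 e i | i < n.-1].
Definition dB_target (k n : nat) (e : n.-tuple 'Z_k) : dB_vertex k n :=
  [tuple nth 0 e i.+1 | i < n.-1].

Definition negrev (k n : nat) (u : n.-tuple 'Z_k) : n.-tuple 'Z_k :=
  [tuple of map -%R (rev u)].

Definition negasym (k n : nat) (u : n.-tuple 'Z_k) : bool := u == negrev u.

Definition pw (k : nat) (a : 'Z_k) : rat :=
  if a == 0 then k%:R / 2 else (nat_of_ord a)%:R.

Definition pseudoweight (k n : nat) (u : n.-tuple 'Z_k) : rat :=
  \sum_(i < n) pw (tnth u i).

Definition r_ (k n : nat) (s : rat) : nat :=
  #|[set u : n.-tuple 'Z_k | pseudoweight u == s]|.

Definition E_ (k n : nat) : {set n.-tuple 'Z_k} :=
  [set e | pseudoweight e < (k * n)%:R / 2].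

Definition H_ (k n : nat) : {set n.-tuple 'Z_k} :=
  [set e | pseudoweight e == (k * n)%:R / 2].

Definition has_shift (k n : nat) (a : n.-tuple 'Z_k) (c : nat) : bool :=
  [forall i : 'I_n, nth 0 a i == nth 0 a ((i + c) %% n)].

(* The minimum is over a nonempty range when n > 0: c = n qualifies. *)
Definition period (k n : nat) (a : n.-tuple 'Z_k) : nat :=
  [arg min_(c < (ord_max : 'I_n.+1) | (0 < c)%N && has_shift a c) (c : nat)].

Definition cyc_shift (k n : nat) (a : n.-tuple 'Z_k) (j : nat) :
    n.-tuple 'Z_k :=
  [tuple nth 0 a ((j + i) %% n) | i < n].

(* A circuit [a_0, ..., a_{n-1}] is identified with its set of edges: the order
   in which they are traversed is recovered from the cyclic shift. *)
Definition circuit (k n : nat) (a : n.-tuple 'Z_k) : {set n.-tuple 'Z_k} :=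
  [set cyc_shift a j | j : 'I_(period a)].

(* Consecutive edges of [circuit a] are indeed adjacent in B_k(n-1), and the
   last one is followed by the first one. *)
Lemma cyc_shift_adj (k n : nat) (a : n.-tuple 'Z_k) (j : nat) :
  dB_target (cyc_shift a j) = dB_source (cyc_shift a j.+1).
Proof.
apply: eq_from_tnth => i; rewrite !tnth_mktuple.
have lt_i : (i.+1 < n)%N by case: n a i => [|n] a [].
rewrite -[i.+1]/(nat_of_ord (Ordinal lt_i)).
rewrite -[X in _ = nth _ _ X]/(nat_of_ord (Ordinal (ltnW lt_i))).
by rewrite -!tnth_nth !tnth_mktuple /= addSnnS.
Qed.

Lemma cyc_shift_period (k n : nat) (a : n.-tuple 'Z_k) :
  (0 < n)%N -> cyc_shift a (period a) = cyc_shift a 0.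
Proof.
move=> n_gt0; apply: eq_from_tnth => i; rewrite !tnth_mktuple add0n.
rewrite /period; case: arg_minnP => [|c /andP[_ /forallP/(_ i)/eqP ac] _].
  rewrite n_gt0 /=; apply/forallP => l.
  by rewrite modnDr modn_small.
by rewrite (modn_small (ltn_ord i)) ac addnC.
Qed.

Definition circuits (k n : nat) : {set {set n.-tuple 'Z_k}} :=
  [set circuit a | a in H_ k n].

Definition negasym_circuit (k n : nat) (C : {set n.-tuple 'Z_k}) : bool :=
  [exists a in C, exists b in C, a == negrev b].

Definition rc_pairs (k n : nat) : {set {set {set n.-tuple 'Z_k}}} :=
  [set [set circuit a; circuit (negrev a)]
     | a in [set a in H_ k n | ~~ negasym_circuit (circuit a)]].

Definition one_from_each_pair (k n : nat) (S : {set {set n.-tuple 'Z_k}}) : Prop :=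
  S \subset cover (rc_pairs k n) /\
  forall P, P \in rc_pairs k n -> #|S :&: P| = 1%N.

Definition is_X (k n : nat) (X : {set dB_edge k n}) : Prop :=
  exists S : {set {set n.-tuple 'Z_k}},
    one_from_each_pair S /\ X = E_ k n :|: \bigcup_(C in S) C.

Definition N_ (i n k : nat) : {set {set n.-tuple 'Z_k}} :=
  [set C in circuits k n
     | negasym_circuit C && (#|[set u in C | negasym u]| == i)].

Definition delta (k : nat) : nat := if odd k then 1%N else 2%N.

(* m stands for the odd part of n. *)
Definition s_ (k n m : nat) : rat :=
  (k%:R ^+ n - n%:R * (#|N_ 0 n k|%:R + #|N_ 2 n k|%:R)
   - m%:R * (#|N_ 1 n k|%:R - (delta k)%:R) - (delta k)%:R) / 2.

(* Main.v *)
(** Negated reversal is an involution sending pseudoweight [s] to [kn - s], so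
    every tuple lies in [X], in the negated reversal of [X], or in a
    negasymmetric circuit; hence [k^n <= 2|X| + sum |C|] over those circuits.
    On a circuit of length [p], negated reversal acts as a reflection of the
    [p]-gon.  It fixes one edge if [p] is odd (and then [p] divides [m]), and
    zero or two edges if [p] is even; composing it with one cyclic shift
    exchanges the last two cases.  Summing both fixed-point counts over the
    negasymmetric circuits thus counts each circuit twice, and the totals are
    the numbers of tuples fixed by the two maps. *)

Require Import Defs.
From mathcomp Require Import all_boot all_order all_algebra.
From mathcomp Require Import zify ring lra.
Set Implicit Arguments.
Unset Strict Implicit.
Unset Printing Implicit Defensive.

Import Order.TTheory GRing.Theory Num.Theory.
Local Open Scope ring_scope.

(** * Fixed points of a reflection of the p-gon *)

(** The solutions are the fixed points of the reflection sending i to e - i. For odd p = 2q+1, the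
    inverse of 2 is q+1. For even p = 2q, reduction modulo p keeps parity, so e must be even; then i
    is e/2 modulo q, which has two lifts below p. *)
Lemma card_double_modn (p e : nat) : (0 < p)%N ->
  #|[set i : 'I_p | i.*2 == e %[mod p]]| =
    (if odd p then 1 else if odd e then 0 else 2)%N.
Proof.
move=> p_gt0; have [p_odd|p_even] := ifPn.
  pose q := p./2; have Ep : p = q.*2.+1 by rewrite -[LHS]odd_double_half p_odd.
  have lt_x : ((e * q.+1) %% p < p)%N by rewrite ltn_mod.
  rewrite -(cards1 (Ordinal lt_x)); apply: eq_card => i; rewrite !inE.
  have inv2 a : (a.*2 * q.+1 = a %[mod p])%N.
    by have -> : (a.*2 * q.+1 = a * p + a)%N by [lia]; rewrite modnMDl.
  apply/eqP/eqP => [Ei|/(congr1 val) /= ->].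
    by apply: val_inj => /=; rewrite -modnMml -Ei modnMml inv2 modn_small.
  by rewrite -mul2n modnMmr mulnA mul2n inv2.
pose q := p./2; have Ep : p = q.*2 by rewrite -[LHS]odd_double_half (negPf p_even).
have q_gt0 : (0 < q)%N by lia.
have [e_odd|e_even] := ifPn.
  apply: eq_card0 => i; rewrite !inE; apply/negP => /eqP/(congr1 odd).
  by rewrite !odd_mod ?Ep ?odd_double // e_odd.
pose f := e./2; have Ee : e = f.*2 by rewrite -[LHS]odd_double_half (negPf e_even).
have lt_f : (f %% q < q)%N by rewrite ltn_mod.
have lt_x : (f %% q < p)%N by lia.
have lt_y : (f %% q + q < p)%N by lia.
have ne_xy : Ordinal lt_x != Ordinal lt_y by rewrite -val_eqE /=; lia.
have -> : 2%N = #|[set Ordinal lt_x; Ordinal lt_y]| by rewrite cards2 ne_xy.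
apply: eq_card => i; rewrite !inE -!val_eqE /=; have lt_i := ltn_ord i.
set l := nat_of_ord i in lt_i *; rewrite Ee Ep -!mul2n -!muln_modr eqn_pmul2l //.
have [lt_lq|le_ql] := ltnP l q; first by rewrite modn_small //; lia.
have -> : l = (l - q + q)%N by lia.
by rewrite modnDr modn_small; lia.
Qed.

(** * Cyclic shifts, periods and circuits *)

Section Shift.
Variables k n : nat.
Implicit Types u v : n.-tuple 'Z_k.
Local Notation T := (n.-tuple 'Z_k).

Lemma nth_cyc_shift u j i :
  (i < n)%N -> nth 0 (cyc_shift u j) i = nth 0 u ((j + i) %% n).
Proof.
by move=> lt_in; rewrite -[i]/(val (Ordinal lt_in)) -tnth_nth tnth_mktuple.
Qed.

Lemma nth_negrev u i : (i < n)%N -> nth 0 (negrev u) i = - nth 0 u (n - i.+1).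
Proof.
by move=> lt_in; rewrite (nth_map 0) ?size_rev ?nth_rev ?size_tuple.
Qed.

Lemma tuple_nth_inj u v :
  (forall i, (i < n)%N -> nth 0 u i = nth 0 v i) -> u = v.
Proof. by move=> Euv; apply: eq_from_tnth => i; rewrite !(tnth_nth 0) Euv. Qed.

Lemma negrevK : involutive (@negrev k n).
Proof.
move=> u; apply: tuple_nth_inj => i lt_in.
rewrite !nth_negrev ?opprK //; last by lia.
by congr nth; lia.
Qed.

Lemma cyc_shift0 u : cyc_shift u 0 = u.
Proof.
by apply: tuple_nth_inj => i lt_in; rewrite nth_cyc_shift // modn_small.
Qed.

Lemma cyc_shiftD u i j : cyc_shift (cyc_shift u i) j = cyc_shift u (i + j).
Proof.
apply: tuple_nth_inj => l lt_ln; have n_gt0 : (0 < n)%N by lia.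
by rewrite !nth_cyc_shift ?ltn_mod // modnDmr addnA.
Qed.

Lemma cyc_shift_modn u j : cyc_shift u (j %% n) = cyc_shift u j.
Proof.
by apply: tuple_nth_inj => i lt_in; rewrite !nth_cyc_shift // modnDml.
Qed.

Lemma cyc_shift_inj j : injective (@cyc_shift k n ^~ j).
Proof.
move=> u v /= Euv; apply: tuple_nth_inj => i lt_in.
have n_gt0 : (0 < n)%N by lia.
(* This is i - j modulo n, written without a truncated subtraction. *)
pose l := ((n - j %% n) + i)%N.
have jl : ((j + l %% n) %% n = i)%N.
  have lt_r : (j %% n < n)%N by rewrite ltn_mod.
  have Ej := divn_eq j n; rewrite modnDmr.
  have -> : (j + l = (j %/ n).+1 * n + i)%N by rewrite /l mulSn; lia.
  by rewrite modnMDl modn_small.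
have := congr1 (fun w : T => nth 0 w (l %% n)) Euv.
by rewrite !nth_cyc_shift ?ltn_mod // jl.
Qed.

(** The dihedral relation: conjugating a rotation by a reflection inverts it. *)
Lemma cyc_shift_negrev u j : cyc_shift (negrev (cyc_shift u j)) j = negrev u.
Proof.
apply: tuple_nth_inj => i lt_in; have n_gt0 : (0 < n)%N by lia.
have lt_r : ((j + i) %% n < n)%N by rewrite ltn_mod.
rewrite nth_cyc_shift // !nth_negrev // nth_cyc_shift; last by lia.
congr (- nth 0 u _).
have Eji := divn_eq (j + i) n.
set q := (_ %/ n)%N in Eji; set r := (_ %% n)%N in Eji lt_r *.
have -> : (j + (n - r.+1) = q * n + (n - i.+1))%N by lia.
by rewrite modnMDl modn_small; lia.
Qed.

Lemma has_shiftE u c : has_shift u c = (cyc_shift u c == u).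
Proof.
apply/forallP/eqP => [uc|uc i].
  apply: tuple_nth_inj => i lt_in; rewrite nth_cyc_shift // addnC.
  by rewrite -(eqP (uc (Ordinal lt_in))).
by rewrite -{1}uc nth_cyc_shift // addnC.
Qed.

Lemma pseudoweight_seq u : pseudoweight u = \sum_(x <- u) pw x.
Proof. by rewrite big_tuple. Qed.

Lemma cyc_shift1 u : cyc_shift u 1 = rot 1 u :> seq _.
Proof.
apply: (@eq_from_nth _ 0); rewrite ?size_rot ?size_tuple // => i lt_in.
rewrite nth_cyc_shift //; case: u => -[|x s] /= /eqP Es; first by lia.
rewrite rot1_cons nth_rcons add1n.
have [lt_is|le_si] := ltnP; first by rewrite modn_small //; lia.
have Ei : i = size s by lia.
by rewrite Ei eqxx Es modnn.
Qed.

Lemma pseudoweight_cyc_shift u j : pseudoweight (cyc_shift u j) = pseudoweight u.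
Proof.
elim: j => [|j IHj]; first by rewrite cyc_shift0.
rewrite -addn1 -cyc_shiftD -IHj !pseudoweight_seq cyc_shift1.
by apply/perm_big; rewrite perm_rot.
Qed.

Hypothesis n_gt0 : (0 < n)%N.

Lemma cyc_shift_n u : cyc_shift u n = u.
Proof. by rewrite -cyc_shift_modn modnn cyc_shift0. Qed.

Lemma periodP u :
  [/\ (0 < period u <= n)%N, cyc_shift u (period u) = u
    & forall c, (0 < c <= n)%N -> cyc_shift u c = u -> (period u <= c)%N].
Proof.
rewrite /period; case: arg_minnP => [|c].
  by rewrite n_gt0 has_shiftE cyc_shift_n eqxx.
rewrite has_shiftE => /andP[c_gt0 /eqP uc] min_c.
split=> [|//|d /andP[d_gt0 le_dn] ud].
  by apply/andP; split; [exact: c_gt0|rewrite -ltnS; exact: ltn_ord].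
have lt_dn : (d < n.+1)%N by [].
by apply: (min_c (Ordinal lt_dn)); rewrite d_gt0 has_shiftE ud eqxx.
Qed.

Lemma period_gt0 u : (0 < period u)%N.
Proof. by case: (periodP u) => /andP[]. Qed.

Lemma cyc_shift_modp u j : cyc_shift u (j %% period u) = cyc_shift u j.
Proof.
have [_ up _] := periodP u.
rewrite [in RHS](divn_eq j (period u)); elim: (j %/ _)%N => [|q IHq] //.
by rewrite mulSn -addnA -cyc_shiftD up.
Qed.

Lemma cyc_shift_id u j : (cyc_shift u j == u) = (period u %| j)%N.
Proof.
have [/andP[p_gt0 p_le] up p_min] := periodP u.
rewrite -cyc_shift_modp /dvdn; have [->|r_neq0] := eqVneq (j %% _)%N 0%N.
  by rewrite cyc_shift0 eqxx.
have lt_r : (j %% period u < period u)%N by rewrite ltn_mod.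
(* The minimum defining [period] ranges over shifts up to n only, hence the upper bound. *)
have r_bnd : (0 < j %% period u <= n)%N.
  by rewrite lt0n r_neq0 (leq_trans (ltnW lt_r)).
apply/negP => /eqP/(p_min _ r_bnd).
by rewrite leqNgt lt_r.
Qed.

Lemma eq_cyc_shift u i j :
  (cyc_shift u i == cyc_shift u j) = (i == j %[mod period u])%N.
Proof.
wlog le_ij : i j / (i <= j)%N.
  case: (leqP i j) => [le_ij|/ltnW le_ji] W; first exact: W.
  by rewrite eq_sym W // eq_sym.
rewrite -[j in LHS](subnK le_ij) -cyc_shiftD (inj_eq (@cyc_shift_inj _)).
by rewrite eq_sym cyc_shift_id [RHS]eq_sym eqn_mod_dvd.
Qed.

Lemma dvdn_period u : (period u %| n)%N.
Proof. by rewrite -cyc_shift_id cyc_shift_n. Qed.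

Lemma circuitP u v : reflect (exists j, v = cyc_shift u j) (v \in circuit u).
Proof.
apply: (iffP imsetP) => [[j _ ->]|[j ->]]; first by exists j.
have lt_j : (j %% period u < period u)%N by rewrite ltn_mod period_gt0.
by exists (Ordinal lt_j); rewrite //= cyc_shift_modp.
Qed.

Lemma mem_circuit u : u \in circuit u.
Proof. by apply/circuitP; exists 0%N; rewrite cyc_shift0. Qed.

Lemma cyc_shift_invertible u j : exists i, u = cyc_shift (cyc_shift u j) i.
Proof.
(* The total shift j + j(n-1) = jn is a multiple of n. *)
exists (j * n.-1)%N; rewrite cyc_shiftD -mulnS prednK //.
by rewrite -cyc_shift_modn modnMl cyc_shift0.
Qed.

Lemma eq_circuit u v : (circuit v == circuit u) = (v \in circuit u).
Proof.
apply/eqP/idP => [<-|/circuitP[j ->]]; first exact: mem_circuit.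
apply/setP => w; apply/circuitP/circuitP => -[i ->].
  by exists (j + i)%N; rewrite cyc_shiftD.
have [l El] := cyc_shift_invertible u j.
by exists (l + i)%N; rewrite -cyc_shiftD -El.
Qed.

Lemma card_circuit u : #|circuit u| = period u.
Proof.
rewrite card_imset ?card_ord // => i j /eqP; rewrite eq_cyc_shift.
by rewrite !modn_small // => /eqP/val_inj.
Qed.

(** One pair of edges of the circuit exchanged by negated reversal is enough: if the i-th shift of
    [u] is the negated reversal of its j-th shift, shifting by j more and using the dihedral
    relation gives d = i + j. *)
Lemma negasym_circuitP u :
  reflect (exists d, negrev u = cyc_shift u d) (negasym_circuit (circuit u)).
Proof.
apply: (iffP exists_inP) => [[x /circuitP[i ->]]|[d Ed]].
  case/exists_inP=> y /circuitP[j ->] /eqP Eij.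
  by exists (i + j)%N; rewrite -cyc_shiftD Eij cyc_shift_negrev.
exists (negrev u); first by apply/circuitP; exists d.
by apply/exists_inP; exists u; rewrite ?mem_circuit.
Qed.

(** Take v to be the i-th shift of [u] and shift the fixed-point equation by i. The dihedral
    relation turns its right side into the (d + c)-th shift of [u], so the condition becomes 2i = d
    + c modulo the period. *)
Lemma card_circuit_fix u d c : negrev u = cyc_shift u d ->
  #|[set v in circuit u | v == cyc_shift (negrev v) c]| =
    (if odd (period u) then 1 else if odd (d + c) then 0 else 2)%N.
Proof.
move=> Ed; rewrite -card_double_modn ?period_gt0 //.
rewrite -(card_in_imset (f := fun i : 'I_(period u) => cyc_shift u i)); last first.
  move=> i j _ _ /eqP; rewrite eq_cyc_shift !modn_small // => /eqP.
  exact: val_inj.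
apply: eq_card => v; rewrite inE.
have fixE i : (cyc_shift u i == cyc_shift (negrev (cyc_shift u i)) c) =
    (i.*2 == d + c %[mod period u])%N.
  rewrite -(inj_eq (@cyc_shift_inj i)) !cyc_shiftD [(c + i)%N]addnC.
  by rewrite -(cyc_shiftD (negrev _)) cyc_shift_negrev Ed cyc_shiftD addnn eq_cyc_shift.
apply/andP/imsetP => [[/imsetP[i _ ->]]|[i]].
  by rewrite fixE => Ei; exists i; rewrite ?inE.
by rewrite inE -fixE => Ei ->; split=> //; apply/circuitP; exists i.
Qed.

(** The period divides 2^q m, so it is odd exactly when it divides the odd factor m. *)
Lemma odd_period q m u : n = (2 ^ q * m)%N -> odd m ->
  odd (period u) = (cyc_shift u m == u).
Proof.
move=> En m_odd; rewrite cyc_shift_id.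
apply/idP/idP => [p_odd|/dvdn_odd]; last by apply.
have := dvdn_period u; rewrite [X in (_ %| X)%N]En Gauss_dvdr //.
by rewrite coprimeXr // coprime_sym coprime2n.
Qed.

End Shift.

(** * Pseudoweight under negation, and tuples fixed by reflections *)

Section Counting.
Variable k : nat.
Hypothesis k_gt1 : (1 < k)%N.

Lemma card_Zk : #|'Z_k| = k.
Proof. by rewrite card_ord Zp_cast. Qed.

Lemma card_self_opp : #|[set z : 'Z_k | z == - z]| = delta k.
Proof.
(* [delta k] unfolds to the number of solutions of 2z = 0 modulo k. *)
case: k k_gt1 => [|[|h]] // _; rewrite -[delta _](@card_double_modn h.+2 0) //.
apply: eq_card => z; rewrite !inE -addr_eq0 -val_eqE /=.
by rewrite -addnn mod0n.
Qed.

(** The convention k/2 at zero makes the identity hold at a = 0 as well. *)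
Lemma pw_opp (a : 'Z_k) : pw (- a) = k%:R - pw a.
Proof.
rewrite /pw oppr_eq0; have [_|a_neq0] := eqVneq; first by lra.
case: k k_gt1 a a_neq0 => [|[|h]] // _ a; rewrite -val_eqE /= => a_neq0.
have lt_a := ltn_ord a; rewrite modn_small ?natrB //; last by lia.
exact: ltnW.
Qed.

Lemma pseudoweight_negrev n (u : n.-tuple 'Z_k) :
  pseudoweight (negrev u) = (k * n)%:R - pseudoweight u.
Proof.
rewrite !pseudoweight_seq big_map (perm_big u) ?perm_rev //=.
rewrite (eq_bigr (fun x => k%:R - pw x)) => [|x _]; last exact: pw_opp.
by rewrite sumrB big_const_seq count_predT size_tuple iter_addr_0 natrM mulr_natr.
Qed.

Definition num_negasym n := #|[set u : n.-tuple 'Z_k | negasym u]|.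

Lemma tuple_rconsP (T : Type) n (u : n.+1.-tuple T) :
  exists (w : n.-tuple T) (z : T), u = [tuple of rcons w z].
Proof.
case: u => s; case: (lastP s) => [|w z] // sz_s.
have sz_w : size w == n by rewrite size_rcons in sz_s.
by exists (Tuple sz_w), z; apply: val_inj.
Qed.

Lemma num_negasym0 : num_negasym 0 = 1%N.
Proof.
rewrite -[RHS]/(#|'Z_k| ^ 0)%N -card_tuple; apply: eq_card => u.
by rewrite !inE (tuple0 u); apply/eqP; apply: val_inj.
Qed.

Lemma num_negasym1 : num_negasym 1 = delta k.
Proof.
rewrite -card_self_opp -(card_imset _ (f := fun z : 'Z_k => [tuple z])); last first.
  by move=> z z' /(congr1 val) [].
apply: eq_card => u; rewrite inE; apply/eqP/imsetP => [|[z]].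
  case/tupleP: u => z u; rewrite (tuple0 u) => /(congr1 val) [Ez].
  by exists z; rewrite ?inE -?Ez //; apply: val_inj.
by rewrite inE => /eqP Ez ->; apply: val_inj; rewrite /= -Ez.
Qed.

(** The first entry is free and forces the last one, and what remains in the middle is an arbitrary
    negasymmetric tuple. *)
Lemma num_negasymSS n : num_negasym n.+2 = (k * num_negasym n)%N.
Proof.
pose f (p : 'Z_k * n.-tuple 'Z_k) := [tuple of p.1 :: rcons p.2 (- p.1)].
have f_inj : injective f.
  move=> [x u] [y v] /(congr1 val) /= [-> Euv]; congr pair.
  by apply: val_inj; have [] := rcons_inj Euv.
rewrite -[X in (X * _)%N]card_Zk -cardsT -cardsX -(card_imset _ f_inj).
have negrevE x (w : n.-tuple 'Z_k) z : negrev [tuple of x :: rcons w z] =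
    [tuple of - z :: rcons (negrev w) (- x)].
  by apply: val_inj; rewrite /= rev_cons rev_rcons map_rcons.
apply: eq_card => u; rewrite inE; apply/eqP/imsetP => [|[[x w]]].
  case/tupleP: u => x u; have [w [z ->]] := tuple_rconsP u.
  rewrite (_ : [tuple of _] = [tuple of x :: rcons w z]); last exact: val_inj.
  rewrite negrevE => /(congr1 val) /= [Ex /rcons_inj[Ew Ez]].
  exists (x, w); last by apply: val_inj; rewrite /= Ez.
  by rewrite !inE; apply/eqP; apply: val_inj.
rewrite !inE /= => /eqP Ew ->; rewrite negrevE -Ew.
by apply: val_inj; rewrite /= opprK.
Qed.

Lemma num_negasymE n :
  num_negasym n = ((if odd n then delta k else 1) * k ^ n./2)%N.
Proof.
have [h le_nh] := ubnP n; elim: h n le_nh => // h IHh [|[|n]] le_nh.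
- by rewrite num_negasym0.
- by rewrite num_negasym1 muln1.
by rewrite num_negasymSS IHh //= ?negbK ?expnS 1?mulnCA //; lia.
Qed.

(** After negated reversal, one shift brings the negated last entry back to the end. The last entry
    is thus self-opposite, and the preceding n entries form a negasymmetric tuple. *)
Lemma card_fix1 n :
  #|[set u : n.+1.-tuple 'Z_k | u == cyc_shift (negrev u) 1]| =
    (delta k * num_negasym n)%N.
Proof.
pose f (p : 'Z_k * n.-tuple 'Z_k) := [tuple of rcons p.2 p.1].
have f_inj : injective f.
  move=> [x u] [y v] /(congr1 val) /= /rcons_inj[Euv ->]; congr pair.
  exact: val_inj.
rewrite -card_self_opp -cardsX -(card_imset _ f_inj).
have shiftE (w : n.-tuple 'Z_k) z :
    cyc_shift (negrev [tuple of rcons w z]) 1 = [tuple of rcons (negrev w) (- z)].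
  by apply: val_inj; rewrite [LHS]cyc_shift1 /= rev_rcons /= rot1_cons.
apply: eq_card => u; rewrite inE; apply/eqP/imsetP => [|[[z w]]].
  have [w [z ->]] := tuple_rconsP u.
  rewrite shiftE => /(congr1 val) /= /rcons_inj[Ew Ez].
  exists (z, w); last exact: val_inj.
  by rewrite !inE /= -Ez eqxx; apply/eqP; apply: val_inj.
rewrite !inE /= => /andP[/eqP Ez /eqP Ew] ->.
by rewrite shiftE -Ew -Ez; apply: val_inj.
Qed.

(** A tuple fixed by the shift by m repeats its first m entries. As m divides n, repetition commutes
    with negated reversal, so the tuple is negasymmetric exactly when its first block is. *)
Lemma card_negasym_periodic n m q : n = (q * m)%N -> (0 < n)%N ->
  #|[set u : n.-tuple 'Z_k | negasym u && (cyc_shift u m == u)]| = num_negasym m.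
Proof.
move=> En n_gt0; have q_gt0 : (0 < q)%N by lia.
have m_gt0 : (0 < m)%N by lia.
have le_mn : (m <= n)%N by rewrite En leq_pmull.
pose f (v : m.-tuple 'Z_k) : n.-tuple 'Z_k := [tuple nth 0 v (i %% m) | i < n].
have nth_f v i : (i < n)%N -> nth 0 (f v) i = nth 0 v (i %% m).
  by move=> lt_in; rewrite -[i]/(val (Ordinal lt_in)) -tnth_nth tnth_mktuple.
have f_inj : injective f.
  move=> v w Evw; apply: tuple_nth_inj => i lt_im.
  by rewrite -[i](modn_small lt_im) -!nth_f ?Evw //; lia.
(* Reversing positions in the whole tuple reverses them inside each block of length m. *)
have modB i : (i < n)%N -> ((n - i.+1) %% m = m - (i %% m).+1)%N.
  move=> lt_in; have Ei := divn_eq i m; have lt_r : (i %% m < m)%N by rewrite ltn_mod.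
  have lt_iq : (i %/ m < q)%N by rewrite ltn_divLR // -En.
  have -> : (n - i.+1 = (q - (i %/ m).+1) * m + (m - (i %% m).+1))%N.
    have -> : n = ((q - (i %/ m).+1) * m + (i %/ m) * m + m)%N.
      by rewrite -mulnDl addnC -mulSn En; congr muln; lia.
    lia.
  by rewrite modnMDl modn_small; lia.
have f_negrev v : negrev (f v) = f (negrev v).
  apply: tuple_nth_inj => i lt_in; rewrite nth_negrev // !nth_f //; last by lia.
  by rewrite nth_negrev ?ltn_mod // modB.
have dvd_mn : (m %| n)%N by rewrite En dvdn_mull.
rewrite /num_negasym -(card_imset _ f_inj); apply: eq_card => u; rewrite inE.
apply/andP/imsetP => [[/eqP u_neg /eqP um]|[v]].
  have u_per i : (i < n)%N -> nth 0 u i = nth 0 u (i %% m).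
    (* Strong induction on the position, going down by m at each step. *)
    have [h] := ubnP i; elim: h i => // h IHh i le_ih lt_in.
    have [lt_im|le_mi] := ltnP i m; first by rewrite modn_small.
    rewrite -[in RHS](subnK le_mi) modnDr -IHh; try lia.
    rewrite -[in RHS]um nth_cyc_shift; last by lia.
    by rewrite subnKC // modn_small.
  pose v : m.-tuple 'Z_k := [tuple nth 0 u i | i < m].
  have Eu : u = f v.
    apply: tuple_nth_inj => i lt_in; rewrite nth_f // u_per //.
    have lt_r : (i %% m < m)%N by rewrite ltn_mod.
    by rewrite -[(i %% m)%N]/(val (Ordinal lt_r)) -(tnth_nth _ v) tnth_mktuple.
  exists v => //; rewrite inE; apply/eqP/f_inj.
  by rewrite -f_negrev -Eu.
rewrite inE => /eqP v_neg ->; split; first by rewrite /negasym f_negrev -v_neg.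
apply/eqP; apply: tuple_nth_inj => i lt_in.
by rewrite nth_cyc_shift // !nth_f ?ltn_mod // modn_dvdm // modnDl.
Qed.

End Counting.

(** * Number and total length of the negasymmetric circuits *)

Section NegasymCircuits.
Variables k n : nat.
Hypotheses (k_gt1 : (1 < k)%N) (n_gt0 : (0 < n)%N).
Implicit Types (u v : n.-tuple 'Z_k) (C : {set n.-tuple 'Z_k}).

Definition negasym_circuits : {set {set n.-tuple 'Z_k}} :=
  [set C in circuits k n | negasym_circuit C].

Definition fix_shift_negrev (c : nat) : {set n.-tuple 'Z_k} :=
  [set u | u == cyc_shift (negrev u) c].

(** Membership in [H_ k n] is automatic: shifts preserve the pseudoweight s and negated reversal
    turns it into kn - s, so s = kn/2. *)
Lemma negasym_circuitsP C :
  reflect (exists u d, C = circuit u /\ negrev u = cyc_shift u d)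
          (C \in negasym_circuits).
Proof.
rewrite inE; apply: (iffP andP) => [[/imsetP[u _ ->]]|[u [d [-> Eu]]]].
  by case/(negasym_circuitP n_gt0) => d Ed; exists u, d.
split; last by apply/negasym_circuitP => //; exists d.
apply/imsetP; exists u => //; rewrite inE; apply/eqP.
have := pseudoweight_negrev k_gt1 u.
by rewrite Eu pseudoweight_cyc_shift; lra.
Qed.

Lemma mem_negasym_circuits u d :
  negrev u = cyc_shift u d -> circuit u \in negasym_circuits.
Proof. by move=> Eu; apply/negasym_circuitsP; exists u, d. Qed.

Lemma fix_shift_negrev_circuit c u :
  u \in fix_shift_negrev c -> circuit u \in negasym_circuits.
Proof.
rewrite inE => /eqP Eu; have [d Ed] := cyc_shift_invertible n_gt0 (negrev u) c.
by apply: (@mem_negasym_circuits u d); rewrite Ed -Eu.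
Qed.

Lemma card_by_circuit (A : {set n.-tuple 'Z_k}) :
    (forall u, u \in A -> circuit u \in negasym_circuits) ->
  #|A| = (\sum_(C in negasym_circuits) #|C :&: A|)%N.
Proof.
move=> A_neg; rewrite -sum1_card (partition_big (@circuit k n) _ A_neg) /=.
apply: eq_bigr => C /negasym_circuitsP[v [d [-> _]]].
rewrite -sum1_card; apply: eq_bigl => u.
by rewrite inE eq_circuit // andbC.
Qed.

Lemma card_fix_parity u d c : negrev u = cyc_shift u d ->
  #|circuit u :&: fix_shift_negrev c| =
    (if odd #|circuit u| then 1 else if odd (d + c) then 0 else 2)%N.
Proof.
move=> Eu; rewrite (card_circuit n_gt0) -(card_circuit_fix n_gt0 c Eu).
by apply: eq_card => v; rewrite !inE.
Qed.

(** On an even circuit exactly one of d and d + 1 is even, so the two counts are 0 and 2 in some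
    order; on an odd circuit both are 1. *)
Lemma card_fix01 C : C \in negasym_circuits ->
  (#|C :&: fix_shift_negrev 0| + #|C :&: fix_shift_negrev 1| = 2)%N.
Proof.
case/negasym_circuitsP=> u [d [-> Eu]]; rewrite !(card_fix_parity _ Eu).
by rewrite addn0 addn1 /=; case: (odd _) => //; case: (odd _).
Qed.

Lemma fix_shift_negrev0 : fix_shift_negrev 0 = [set u | negasym u].
Proof. by apply/setP => u; rewrite !inE cyc_shift0. Qed.

Lemma mem_N i C :
  (C \in N_ i n k) = (C \in negasym_circuits) && (#|C :&: fix_shift_negrev 0| == i).
Proof.
rewrite !inE -andbA; congr [&& _, _ & _ == i].
by apply: eq_card => u; rewrite !inE cyc_shift0.
Qed.

Lemma card_N i :
  #|N_ i n k| =
    (\sum_(C in negasym_circuits) (#|C :&: fix_shift_negrev 0| == i))%N.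
Proof.
by rewrite -sum1_card (eq_bigl _ _ (mem_N i)) big_mkcondr.
Qed.

Lemma mem_N1 C : (C \in N_ 1 n k) = (C \in negasym_circuits) && odd #|C|.
Proof.
rewrite mem_N; apply: andb_id2l => /negasym_circuitsP[u [d [-> Eu]]].
by rewrite (card_fix_parity _ Eu); case: (odd _) => //; case: (odd _).
Qed.

Lemma card_N012 : (#|N_ 0 n k| + #|N_ 1 n k| + #|N_ 2 n k| = #|negasym_circuits|)%N.
Proof.
rewrite !card_N -!big_split -sum1_card /=; apply: eq_bigr => C.
case/negasym_circuitsP=> u [d [-> Eu]]; rewrite (card_fix_parity _ Eu).
by case: (odd _) => //; case: (odd _).
Qed.

Lemma double_card_negasym_circuits :
  (#|negasym_circuits|.*2 = #|fix_shift_negrev 0| + #|fix_shift_negrev 1|)%N.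
Proof.
rewrite !card_by_circuit; try exact: fix_shift_negrev_circuit.
rewrite -big_split /= -muln2 -sum1_card big_distrl /=.
by apply: eq_bigr => C /card_fix01->; rewrite mul1n.
Qed.

(** The circuits in [N_ 1 n k] are the odd ones, and each contains a single negasymmetric edge. They
    thus correspond to the negasymmetric tuples of odd period, that is, those fixed by the shift by
    m. *)
Lemma card_N1 t m : n = (2 ^ t * m)%N -> odd m -> #|N_ 1 n k| = num_negasym k m.
Proof.
move=> En m_odd; rewrite -(card_negasym_periodic k_gt1 En n_gt0).
rewrite card_by_circuit => [|u]; last first.
  rewrite inE => /andP[u_neg _]; apply: (@fix_shift_negrev_circuit 0).
  by rewrite fix_shift_negrev0 inE.
rewrite -sum1_card (eq_bigl _ _ mem_N1) big_mkcondr /=.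
apply: eq_bigr => C /negasym_circuitsP[u [d [-> Eu]]].
have periodE v : v \in circuit u -> odd #|circuit u| = (cyc_shift v m == v).
  rewrite -(eq_circuit n_gt0) => /eqP<-.
  by rewrite (card_circuit n_gt0) (odd_period n_gt0 _ En).
case: ifPn => [odd_u|even_u]; symmetry.
  transitivity #|circuit u :&: fix_shift_negrev 0|.
    apply: eq_card => v; rewrite fix_shift_negrev0 !inE; apply: andb_id2l => v_u.
    by rewrite -periodE // odd_u andbT.
  by rewrite (card_fix_parity _ Eu) odd_u.
apply: eq_card0 => v; rewrite !inE; apply/negP => /andP[v_u].
by rewrite -periodE // (negPf even_u) andbF.
Qed.

Lemma card_N0_N2_odd : odd n -> #|N_ 0 n k| = 0%N /\ #|N_ 2 n k| = 0%N.
Proof.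
move=> n_odd; rewrite !card_N; split; apply: big1 => C.
all: case/negasym_circuitsP=> u [d [-> Eu]]; rewrite (card_fix_parity _ Eu).
all: by rewrite (card_circuit n_gt0) (dvdn_odd (dvdn_period n_gt0 u)).
Qed.

(** Circuits of length 1 inside [N_ 1 n k]. Bounding their length by 1 instead of m produces the
    [delta k] corrections in [s_]. *)
Definition const_circuits : {set {set n.-tuple 'Z_k}} :=
  [set [set nseq_tuple n z] | z in [set z : 'Z_k | z == - z]].

Lemma card_const_circuits : #|const_circuits| = delta k.
Proof.
rewrite card_imset ?card_self_opp // => y z /set1_inj/(congr1 val) /=.
by case: n n_gt0 => [//|h] _ [].
Qed.

Lemma const_circuits_sub_N1 : const_circuits \subset N_ 1 n k.
Proof.
apply/subsetP => C /imsetP[z]; rewrite inE => /eqP Ez ->.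
have nth_z i : (i < n)%N -> nth 0 (nseq_tuple n z) i = z.
  by move=> lt_in; rewrite nth_nseq lt_in.
have z_shift j : cyc_shift (nseq_tuple n z) j = nseq_tuple n z.
  apply: tuple_nth_inj => i lt_in.
  by rewrite nth_cyc_shift // !nth_z ?ltn_mod.
have z_neg : negrev (nseq_tuple n z) = nseq_tuple n z.
  apply: tuple_nth_inj => i lt_in.
  by rewrite nth_negrev // !nth_z -?Ez //; lia.
have -> : [set nseq_tuple n z] = circuit (nseq_tuple n z).
  apply/setP => v; rewrite inE; apply/eqP/(circuitP n_gt0) => [->|[j ->]].
    by exists 0%N; rewrite z_shift.
  exact: z_shift.
rewrite mem_N1 (@mem_negasym_circuits _ 0) ?z_shift //= (card_circuit n_gt0).
suff : (period (nseq_tuple n z) %| 1)%N by rewrite dvdn1 => /eqP->.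
by rewrite -(cyc_shift_id n_gt0) z_shift.
Qed.

(** Lengths are at most n on [N_ 0 n k] and [N_ 2 n k]. On [N_ 1 n k] they are odd divisors of n,
    hence at most m, and constant circuits have length 1. *)
Lemma sum_card_negasym_circuits t m : n = (2 ^ t * m)%N -> odd m ->
  (\sum_(C in negasym_circuits) #|C| <=
     n * (#|N_ 0 n k| + #|N_ 2 n k|) + m * (#|N_ 1 n k| - delta k) + delta k)%N.
Proof.
move=> En m_odd; have m_gt0 : (0 < m)%N by case: m m_odd {En}.
have sNC : N_ 1 n k \subset negasym_circuits.
  by apply/subsetP => C; rewrite mem_N1 => /andP[].
rewrite (bigID [in N_ 1 n k]) /= addnC -addnA; apply: leq_add.
  rewrite !card_N -big_split big_distrr /= big_mkcondr /=.
  apply: leq_sum => C C_neg; rewrite mem_N C_neg /=.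
  have := C_neg; case/negasym_circuitsP=> u [d [-> Eu]].
  rewrite (card_fix_parity _ Eu) (card_circuit n_gt0).
  have le_pn := dvdn_leq n_gt0 (dvdn_period n_gt0 u).
  by case: (odd _) => //; case: (odd _); rewrite /= ?muln1.
rewrite (eq_bigl (fun C => C \in N_ 1 n k)) => [|C]; last first.
  by apply/andb_idl/(subsetP sNC).
rewrite (bigID [in const_circuits]) /= addnC; apply: leq_add.
  rewrite -card_const_circuits -(cardsDS const_circuits_sub_N1) mulnC -sum_nat_const.
  rewrite (eq_bigl (fun C => C \in N_ 1 n k :\: const_circuits)) => [|C]; last first.
    by rewrite in_setD andbC.
  apply: leq_sum => C; rewrite in_setD mem_N1 => /and3P[_ /negasym_circuitsP[u [d [-> _]]]].
  rewrite (card_circuit n_gt0) (odd_period n_gt0 u En m_odd) (cyc_shift_id n_gt0).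
  exact: dvdn_leq.
rewrite -card_const_circuits -sum1_card.
rewrite (eq_bigl (fun C => C \in const_circuits)) => [|C]; last first.
  by apply/andb_idl/(subsetP const_circuits_sub_N1).
by apply: leq_sum => C /imsetP[z _ ->]; rewrite cards1.
Qed.

(** * Covering all tuples, and the lower bounds on the size of X *)

Lemma pair_transversal_meets (S : {set {set n.-tuple 'Z_k}}) u :
    one_from_each_pair S -> u \in H_ k n -> ~~ negasym_circuit (circuit u) ->
  (u \in \bigcup_(C in S) C) || (negrev u \in \bigcup_(C in S) C).
Proof.
move=> [_ S1] uH u_asym; pose P := [set circuit u; circuit (negrev u)].
have PP : P \in rc_pairs k n by apply: imset_f; rewrite inE uH.
have /card_gt0P[C] : (0 < #|S :&: P|)%N by rewrite S1.
rewrite !inE => /andP[CS /orP[]/eqP EC]; apply/orP; [left|right].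
  by apply/bigcupP; exists C; rewrite // EC mem_circuit.
by apply/bigcupP; exists C; rewrite // EC mem_circuit.
Qed.

(** Negated reversal reflects pseudoweights about kn/2. *)
Lemma pseudoweight_cases u : [|| u \in E_ k n, negrev u \in E_ k n | u \in H_ k n].
Proof.
rewrite !inE (pseudoweight_negrev k_gt1); case: ltgtP => //= [lt_u|_].
  by rewrite orbF; lra.
by rewrite orbT.
Qed.

(** Each of the two lower bounds is an instance: [Y] is [H_ k n] for the first, and the union of the
    negasymmetric circuits for the second. *)
Lemma card_negrev_closure (X Y : {set n.-tuple 'Z_k}) :
    (forall u, [|| u \in X, negrev u \in X | u \in Y]) ->
  (k ^ n <= #|X|.*2 + #|Y|)%N.
Proof.
move=> cov; rewrite -{1}(card_Zk k_gt1) -card_tuple -cardsT.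
have sub : [set: n.-tuple 'Z_k] \subset (X :|: @negrev k n @: X) :|: Y.
  apply/subsetP => u _; have := cov u; rewrite !inE.
  case/or3P=> [->|nu|->]; rewrite ?orbT //.
  by rewrite -[u]negrevK (imset_f _ nu) orbT.
apply: leq_trans (subset_leq_card sub) _; apply: leq_trans (leq_card_setU _ _) _.
rewrite leq_add2r -addnn; apply: leq_trans (leq_card_setU _ _) _.
by rewrite leq_add2l leq_imset_card.
Qed.

Lemma card_X_H (X : {set dB_edge k n}) : is_X X -> (k ^ n <= #|X|.*2 + #|H_ k n|)%N.
Proof.
case=> S [_ ->]; apply: card_negrev_closure => u.
by have := pseudoweight_cases u; rewrite !in_setU => /or3P[] ->; rewrite ?orbT.
Qed.

Lemma card_X_negasym (X : {set dB_edge k n}) :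
  is_X X -> (k ^ n <= #|X|.*2 + \sum_(C in negasym_circuits) #|C|)%N.
Proof.
case=> S [S1 EX].
have : (k ^ n <= #|X|.*2 + #|\bigcup_(C in negasym_circuits) C|)%N.
  apply: card_negrev_closure => u.
  have := pseudoweight_cases u; rewrite EX !in_setU => /or3P[->|->|uH]; rewrite ?orbT //.
  have [u_neg|u_asym] := boolP (negasym_circuit (circuit u)); last first.
    by have /orP[->|->] := pair_transversal_meets S1 uH u_asym; rewrite ?orbT.
  apply/or3P/Or33/bigcupP; exists (circuit u); last exact: mem_circuit.
  by rewrite inE u_neg imset_f.
move/leq_trans; apply; rewrite leq_add2l.
elim/big_ind2: _ => [|a A b B le_a le_b|//]; first by rewrite cards0.
by apply: leq_trans (leq_card_setU _ _) _; apply: leq_add.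
Qed.

End NegasymCircuits.

Theorem theorem4p13 (k n t m : nat) (hk : (3 <= k)%N) (hn : (3 <= n)%N)
    (hnm : n = (2 ^ t * m)%N) (hm : odd m) :
  [/\ forall X : {set dB_edge k n}, is_X X ->
        Num.max ((k%:R ^+ n - (r_ k n ((k * n)%:R / 2))%:R) / 2) (s_ k n m)
          <= #|X|%:R :> rat,
      odd n ->
        s_ k n m =
          (k%:R ^+ n
           - (delta k)%:R * (n%:R * (k%:R ^+ ((n - 1) %/ 2) - 1) + 1)) / 2
    & ~~ odd n ->
        s_ k n m =
          (k%:R ^+ n
           - n%:R * k%:R ^+ ((n - 2) %/ 2) / 2 * ((delta k)%:R ^+ 2 + k%:R)
           + n%:R * (delta k)%:R * k%:R ^+ ((m - 1) %/ 2)
           - m%:R * (delta k)%:R * (k%:R ^+ ((m - 1) %/ 2) - 1)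
           - (delta k)%:R) / 2].
Proof.
have k_gt1 : (1 < k)%N by apply: ltn_trans hk.
have n_gt0 : (0 < n)%N by apply: ltn_trans hn.
have N1E : #|N_ 1 n k| = (delta k * k ^ ((m - 1) %/ 2))%N.
  rewrite (card_N1 k_gt1 n_gt0 hnm hm) num_negasymE // hm divn2.
  by congr (_ * _ ^ _)%N; lia.
split=> [X X_X|n_odd|n_even].
- have leH : k%:R ^+ n <= #|X|%:R *+ 2 + (r_ k n ((k * n)%:R / 2))%:R :> rat.
    by rewrite -natrX -mulrnA muln2 -natrD ler_nat; exact: card_X_H.
  have leS := leq_trans (card_X_negasym k_gt1 n_gt0 X_X)
    (leq_add (leqnn _) (sum_card_negasym_circuits k_gt1 n_gt0 hnm hm)).
  have {leS} : k%:R ^+ n <= #|X|%:R *+ 2 +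
      (n%:R * (#|N_ 0 n k|%:R + #|N_ 2 n k|%:R) +
       m%:R * (#|N_ 1 n k|%:R - (delta k)%:R) + (delta k)%:R) :> rat.
    (* The subtraction of [delta k] in nat is not truncated, since the constant circuits lie in
       [N_ 1 n k]. *)
    rewrite -natrB -?natrX -?mulrnA ?muln2 -?natrD -?natrM -?natrD ?ler_nat //.
    rewrite -(card_const_circuits k_gt1 n_gt0).
    exact: subset_leq_card (const_circuits_sub_N1 k_gt1 n_gt0).
  by move: leH; rewrite ge_max /s_ {X_X N1E} => leH leS; apply/andP; split; lra.
- have [N0 N2] := card_N0_N2_odd k_gt1 n_gt0 n_odd.
  have En : n = m.
    (* A positive t would make n even. *)
    by case: t hnm => [|t]; rewrite ?mul1n // => En; move: n_odd; rewrite En expnS -mulnA oddM.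
  by rewrite /s_ N0 N2 N1E natrM natrX -En; ring.
have N012 := card_N012 k_gt1 n_gt0.
(* For even n, twice the number of negasymmetric circuits is k^(n/2) + delta^2 k^((n-2)/2). With
   |N_1| known, this determines |N_0| + |N_2|, the only combination of the two that enters [s_]. *)
have := double_card_negasym_circuits k_gt1 n_gt0.
rewrite -N012 fix_shift_negrev0 -/(num_negasym k n) num_negasymE // (negPf n_even).
have -> : #|@fix_shift_negrev k n 1| = (delta k * (delta k * k ^ ((n - 2) %/ 2)))%N.
  case: n hn n_even {hnm N1E n_gt0 N012} => // h _ h_odd; rewrite card_fix1 // num_negasymE //.
  move: h_odd => /= /negPn h_odd; rewrite h_odd divn2.
  by congr (_ * (_ * _ ^ _))%N; lia.
have -> : n./2 = ((n - 2) %/ 2).+1 by rewrite divn2; lia.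
rewrite expnS -addnn mul1n => /(congr1 (fun x => x%:R : rat)).
rewrite !natrD N1E !natrM !natrX => E.
rewrite /s_ N1E natrM natrX.
set N0 := _%:R in E *; set N2 := #|N_ 2 n k|%:R in E *.
set K := k%:R ^+ ((n - 2) %/ 2) in E *; set M := k%:R ^+ ((m - 1) %/ 2) in E *.
have -> : N0 = (k%:R * K + (delta k)%:R * ((delta k)%:R * K)) / 2 - (delta k)%:R * M - N2.
  lra.
ring.
Qed.
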